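(* Let $F$ be a $k$-CNF formula and let $\pi$ be an $r$-DNF resolution refutation of $F$ with space at most $s$. Then there exists a resolution refutation $\pi'$ of $F$ of width at most $(s-2)r + k - 1$.
   Context: A literal is a variable $x$ or its negation $\overline{x}$. A clause is a disjunction of literals, a term a conjunction of literals; an $r$-term has at most $r$ literals; a $k$-CNF formula is a conjunction of clauses with at most $k$ literals each (assumed not to contain the empty clause $0$); an $r$-DNF formula is a disjunction of $r$-terms. An $r$-DNF resolution refutation of a CNF formula $F$ is a sequence of configurations (sets of $r$-DNF formulas) $(\mathbb{C}_0,\dots,\mathbb{C}_\tau)$ with $\mathbb{C}_0=\emptyset$, $0\in\mathbb{C}_\tau$, and each $\mathbb{C}_t$ obtained from $\mathbb{C}_{t-1}$ by: axiom download ($\mathbb{C}_t=\mathbb{C}_{t-1}\cup\{A\}$ for a clause $A$ of $F$); inference ($\mathbb{C}_t=\mathbb{C}_{t-1}\cup\{D\}$ where $D$ follows from formulas in $\mathbb{C}_{t-1}$ by one of the rules, with $G,H$ $r$-DNF formulas, $T,T'$ $r$-terms and $a_i$ literals: $r$-cut: from $(a_1\land\cdots\land a_{r'})\lor G$ and $\overline{a}_1\lor\cdots\lor\overline{a}_{r'}\lor H$ with $r'\le r$ infer $G\lor H$; $\land$-introduction: from $G\lor T$ and $G\lor T'$ infer $G\lor(T\land T')$ provided $|T\cup T'|\le r$; $\land$-elimination: from $G\lor T$ infer $G\lor T'$ for nonempty $T'\subseteq T$; weakening: from $G$ infer $G\lor H$); or erasure ($\mathbb{C}_t=\mathbb{C}_{t-1}\setminus\{C\}$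 for some $C\in\mathbb{C}_{t-1}$). The space of the refutation is the maximum number of formulas in any configuration. For $r=1$ this is (standard) resolution, whose essential rule is: from $C\lor x$ and $D\lor\overline{x}$ infer $C\lor D$ (plus weakening). The width of a resolution refutation is the maximum number of literals in any clause appearing in it. *)

(* Defs.v *)
From HB Require Import structures.
From mathcomp Require Import all_boot all_order all_algebra.
From mathcomp Require Import finmap.
Set Implicit Arguments.
Unset Strict Implicit.
Unset Printing Implicit Defensive.
Local Open Scope fset_scope.

(* [(x, true)] is the literal x and [(x, false)] its negation.  Clauses and
   terms are both sets of literals and a DNF is a set of terms, so that
   disjunction of clauses or DNFs, and conjunction of terms, is union. *)
Definition literal (V : choiceType) : choiceType := (V * bool)%type.
Definition clause (V : choiceType) : choiceType := {fset literal V}.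
Definition term (V : choiceType) : choiceType := {fset literal V}.
Definition cnf (V : choiceType) : choiceType := {fset clause V}.
Definition dnf (V : choiceType) : choiceType := {fset term V}.

Definition neg (V : choiceType) (a : literal V) : literal V := (a.1, ~~ a.2).

Definition neg_term (V : choiceType) (T : term V) : clause V :=
  [fset neg a | a in T].

Definition dnf_of_clause (V : choiceType) (A : clause V) : dnf V :=
  [fset [fset a] | a in A].

Definition kcnf (V : choiceType) (k : nat) (F : cnf V) : Prop :=
  (fset0 : clause V) \notin F /\ forall A, A \in F -> #|` A| <= k.

Definition rdnf (V : choiceType) (r : nat) (G : dnf V) : Prop :=
  forall T, T \in G -> #|` T| <= r.

(* The space-oriented proof format, for an arbitrary type [X] of formulas:
   [infers CC D] says that D follows from formulas in CC by a single rule. *)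
Inductive step (X : choiceType) (axioms : {fset X})
    (infers : {fset X} -> X -> Prop) (CC : {fset X}) : {fset X} -> Prop :=
| Download A of A \in axioms : step axioms infers CC (A |` CC)
| Inference D of infers CC D : step axioms infers CC (D |` CC)
| Erasure C of C \in CC : step axioms infers CC (CC `\ C).

Definition refutation (X : choiceType) (axioms : {fset X})
    (infers : {fset X} -> X -> Prop) (bot : X) (p : seq {fset X}) : Prop :=
  [/\ ohead p = Some fset0,
      bot \in last fset0 p &
      forall t, t.+1 < size p ->
        step axioms infers (nth fset0 p t) (nth fset0 p t.+1)].

Definition refutation_space (X : choiceType) (p : seq {fset X}) : nat :=
  \max_(CC <- p) #|` CC|.

(* G, H, T and T' need not be constrained to be r-DNFs and r-terms here, as
   [rdnf_refutation] requires this of all premises and conclusions. *)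
Inductive rdnf_infers (V : choiceType) (r : nat) (CC : {fset dnf V}) :
    dnf V -> Prop :=
| RCut (T : term V) (G H : dnf V) of
    #|` T| <= r & T |` G \in CC & dnf_of_clause (neg_term T) `|` H \in CC :
    rdnf_infers r CC (G `|` H)
| AndIntro (T T' : term V) (G : dnf V) of
    #|` T `|` T'| <= r & T |` G \in CC & T' |` G \in CC :
    rdnf_infers r CC ((T `|` T') |` G)
| AndElim (T T' : term V) (G : dnf V) of
    T' != fset0 & T' `<=` T & T |` G \in CC :
    rdnf_infers r CC (T' |` G)
| DnfWeakening (G H : dnf V) of G \in CC : rdnf_infers r CC (G `|` H).

Definition rdnf_refutation (V : choiceType) (r : nat) (F : cnf V)
    (p : seq {fset dnf V}) : Prop :=
  (forall CC, CC \in p -> forall D, D \in CC -> rdnf r D) /\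
  refutation [fset dnf_of_clause A | A in F] (@rdnf_infers V r) fset0 p.

Inductive res_infers (V : choiceType) (CC : {fset clause V}) :
    clause V -> Prop :=
| Resolve (x : V) (C D : clause V) of
    (x, true) |` C \in CC & (x, false) |` D \in CC : res_infers CC (C `|` D)
| ClauseWeakening (C D : clause V) of C \in CC : res_infers CC (C `|` D).

Definition res_refutation (V : choiceType) (F : cnf V)
    (p : seq {fset clause V}) : Prop :=
  refutation F (@res_infers V) fset0 p.

Definition refutation_width (V : choiceType) (p : seq {fset clause V}) : nat :=
  \max_(CC <- p) \max_(C <- CC) #|` C|.

(* Main.v *)
(* Atserias-Dalmau argument.  Work backwards through the refutation with the
   invariant that every consistent set of literals satisfying the current
   configuration falsifies some clause derivable in narrow width.  Inference
   steps preserve it by soundness.  At a download of a clause A, a satisfying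
   set may be shrunk to one literal set of size at most r per formula, and A
   is then resolved against the clauses falsified by its extensions by the
   single literals of A.  The empty set satisfies the empty configuration, so
   the empty clause is derivable. *)
Require Import Defs.
From HB Require Import structures.
From mathcomp Require Import all_boot all_order all_algebra.
From mathcomp Require Import finmap.
From mathcomp Require Import zify.
Set Implicit Arguments.
Unset Strict Implicit.
Unset Printing Implicit Defensive.

Local Open Scope fset_scope.

(** * Induction along a refutation *)

Section Refutations.
Variables (X : choiceType) (axioms : {fset X}).
Variables (infers : {fset X} -> X -> Prop) (bot : X).

(** The step receives membership of both configurations in [p], so that bounds holding throughout
    [p] can be applied to them. *)
Lemma refutation_ind (p : seq {fset X}) (I : {fset X} -> Prop) :
  refutation axioms infers bot p -> I fset0 ->
  (forall CC CC', CC \in p -> CC' \in p -> step axioms infers CC CC' ->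
    I CC -> I CC') ->
  I (last fset0 p).
Proof.
case=> p0 _ steps I0 IS; have p_gt0 : 0 < size p by case: p p0 {steps IS}.
suff It t : t < size p -> I (nth fset0 p t).
  by rewrite -nth_last; apply: It; rewrite ltn_predL.
elim: t => [|t IHt] tp; first by case: p p0 {p_gt0 steps IS tp} => //= ? ? [->].
have tp' := ltnW tp.
by apply: IS (steps t tp) (IHt tp'); apply: mem_nth.
Qed.

Lemma refutation_space_ge (p : seq {fset X}) CC :
  CC \in p -> #|` CC| <= refutation_space p.
Proof. by move=> CCp; rewrite /refutation_space (leq_bigmax_seq CC). Qed.

End Refutations.

(** * Partial assignments and soundness of the rules *)

Section Literals.
Variable V : choiceType.
Implicit Types (a b : literal V) (alpha beta T : {fset literal V}).
Implicit Types (D G : dnf V) (CC : {fset dnf V}).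

Lemma negK : involutive (@neg V).
Proof. by case=> x b; rewrite /neg /= negbK. Qed.

Lemma mem_neg_term T a : (a \in neg_term T) = (neg a \in T).
Proof.
apply/imfsetP/idP => /= [[b bT ->]|aT]; first by rewrite negK.
by exists (neg a) => //; rewrite negK.
Qed.

Lemma card_neg_term T : #|` neg_term T| = #|` T|.
Proof. by rewrite /neg_term card_imfset //; apply: inv_inj negK. Qed.

Definition consistent alpha := forall a, a \in alpha -> neg a \notin alpha.

(** A set of literals acts as a partial assignment. A DNF counts as satisfied only once a whole term
    lies in the set, so satisfaction is monotone and has small witnesses. *)
Definition sat alpha D := exists2 T, T \in D & T `<=` alpha.

Definition sat_all alpha CC := forall D, D \in CC -> sat alpha D.

Lemma consistent0 : consistent fset0.
Proof. by move=> a; rewrite inE. Qed.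

Lemma consistentS alpha beta :
  beta `<=` alpha -> consistent alpha -> consistent beta.
Proof.
move=> /fsubsetP ba ca a /ba /ca; apply: contra; exact: ba.
Qed.

Lemma neg_neq a : neg a != a.
Proof. by case: a => x []; rewrite /neg xpair_eqE andbC. Qed.

Lemma consistentU1 alpha a :
  consistent alpha -> neg a \notin alpha -> consistent (a |` alpha).
Proof.
move=> ca na b; rewrite !inE => /orP[/eqP->|b_al].
  by rewrite negb_or neg_neq na.
rewrite negb_or ca // andbT.
by apply: contra na => /eqP <-; rewrite negK.
Qed.

Lemma satS alpha beta D : alpha `<=` beta -> sat alpha D -> sat beta D.
Proof. by move=> ab [T TD Ta]; exists T => //; apply: fsubset_trans ab. Qed.

Lemma sat_clause a (A : clause V) : a \in A -> sat [fset a] (dnf_of_clause A).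
Proof. by move=> aA; exists [fset a] => //; apply: in_imfset. Qed.

(** Consistency enters at the cut: if both premises were satisfied through the parts cut away,
    [alpha] would contain a literal and its negation. *)
Lemma rdnf_infers_sound r CC D alpha :
  rdnf_infers r CC D -> consistent alpha -> sat_all alpha CC -> sat alpha D.
Proof.
move=> inf ca sa; case: inf => {D}.
- move=> T G H _ /sa[T1 T1G T1a] /sa[T2 T2H T2a].
  move: T1G; rewrite !inE => /orP[/eqP T1T|T1G]; last first.
    by exists T1 => //; rewrite inE T1G.
  move: T2H; rewrite !inE => /orP[|T2H]; last first.
    by exists T2 => //; rewrite inE T2H orbT.
  case/imfsetP => b /=; rewrite mem_neg_term => bT eT2.
  have nb : neg b \in alpha by apply: (fsubsetP T1a); rewrite T1T.
  have := ca _ nb; rewrite negK => /negP[].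
  by apply: (fsubsetP T2a); rewrite eT2 inE.
- move=> T T' G _ /sa[T1 T1G T1a] /sa[T2 T2G T2a].
  move: T1G; rewrite !inE => /orP[/eqP T1T|T1G]; last first.
    by exists T1 => //; rewrite !inE T1G orbT.
  move: T2G; rewrite !inE => /orP[/eqP T2T|T2G]; last first.
    by exists T2 => //; rewrite !inE T2G orbT.
  exists (T `|` T'); first by rewrite !inE eqxx.
  by rewrite fsubUset -T1T -T2T T1a.
- move=> T T' G _ T'T /sa[T1]; rewrite !inE => /orP[/eqP->|T1G] T1a.
    by exists T'; rewrite ?inE ?eqxx // (fsubset_trans T'T).
  by exists T1; rewrite // !inE T1G orbT.
- by move=> G H /sa[T TG Ta]; exists T; rewrite // inE TG.
Qed.

Lemma sat_all_small r CC alpha :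
  (forall D, D \in CC -> rdnf r D) -> sat_all alpha CC ->
  exists beta, [/\ beta `<=` alpha, sat_all beta CC & #|` beta| <= #|` CC| * r].
Proof.
elim/finSet_rect: CC => CC IH rCC sa.
have [->|[D DCC]] := fset_0Vmem CC.
  by exists fset0; split; rewrite ?fsub0set ?cardfs0 // => D; rewrite inE.
have [|E /fsetD1P[_ /rCC]//|E /fsetD1P[_ /sa]//|beta [ba sb cb]] := IH (CC `\ D).
  by rewrite fproperD1.
have [T TD Ta] := sa _ DCC.
exists (T `|` beta); split; first by rewrite fsubUset Ta.
  move=> E ECC; have [->|ED] := eqVneq E D; first by exists T; rewrite ?fsubsetUl.
  by apply: satS (fsubsetUr _ _) (sb _ _); apply/fsetD1P.
rewrite (cardfsD1 D CC) DCC mulnDl mul1n.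
apply: leq_trans (leq_add (rCC _ DCC _ TD) cb).
by rewrite cardfsU leq_subr.
Qed.

End Literals.

(** * Excluding degenerate parameters *)

Section Degenerate.
Variables (V : choiceType) (F : cnf V) (r : nat) (p : seq {fset dnf V}).
Hypothesis rp : rdnf_refutation r F p.

(** Until an axiom is downloaded, soundness keeps every formula satisfied by the empty assignment,
    which cannot satisfy the empty DNF. *)
Lemma rdnf_refutation_uses_axiom :
  exists2 A, A \in F & rdnf r (dnf_of_clause A).
Proof.
have [rdnf_p ref_p] := rp.
pose I CC := (exists2 A, A \in F & rdnf r (dnf_of_clause A)) \/
  @sat_all V fset0 CC.
have [] : I (last fset0 p).
- apply: (refutation_ind ref_p); first by right.
  move=> CC CC' _ CC'p st [|sCC]; first by left.
  case: st CC'p => [_ /imfsetP[A /= AF ->]|D inf|D _] CC'p.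
  + by left; exists A => //; apply: rdnf_p CC'p _ _; rewrite !inE eqxx.
  + right=> E /fset1UP[->|/sCC//].
    exact: rdnf_infers_sound inf (@consistent0 V) sCC.
  + by right=> E /fsetD1P[_ /sCC].
- by [].
- by case: ref_p => _ bot _ /(_ _ bot)[].
Qed.

(* In space 2, a new formula can only be inferred from a single formula, and
   every axiom is satisfiable on its own. *)
Lemma rdnf_refutation_space_gt2 : fset0 \notin F -> 2 < refutation_space p.
Proof.
move=> F0; have [_ ref_p] := rp; rewrite ltnNge; apply/negP => sp.
pose satisfiable (D : dnf V) := exists2 alpha, consistent alpha & sat alpha D.
pose I (CC : {fset dnf V}) := forall D, D \in CC -> satisfiable D.
have : I (last fset0 p).
  apply: (refutation_ind ref_p) => // CC CC' _ CC'p st sCC.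
  case: st CC'p => [_ /imfsetP[A /= AF ->]|D inf|D _] CC'p E.
  - case/fset1UP=> [->|/sCC//].
    have [A0|[a aA]] := fset_0Vmem A; first by rewrite A0 (negPf F0) in AF.
    exists [fset a]; last exact: sat_clause.
    by move=> b /fset1P->; rewrite inE neg_neq.
  - case/fset1UP=> [->|/sCC//]; have [/sCC//|DCC] := boolP (D \in CC).
    have := leq_trans (refutation_space_ge CC'p) sp.
    rewrite cardfsU1 DCC add1n ltnS.
    have [CC0 _|[C CCC] CC1] := fset_0Vmem CC.
      exists fset0; first exact: consistent0.
      apply: rdnf_infers_sound inf (@consistent0 V) _.
      by move=> C; rewrite CC0.
    have CCE : CC = [fset C].
      by apply/esym/eqP; rewrite eqEfcard fsub1set CCC cardfs1.
    have [alpha ca sa] := sCC _ CCC; exists alpha => //.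
    by apply: rdnf_infers_sound inf ca _; rewrite CCE => _ /fset1P->.
  - by move=> /fsetD1P[_ /sCC].
by case: ref_p => _ bot _ /(_ _ bot)[? _ []].
Qed.

End Degenerate.

(** * Resolution in bounded width *)

Section NarrowResolution.
Variables (V : choiceType) (F : cnf V) (w : nat).

(** Derivability is kept free of configurations here; [narrow_refutation] turns it back into a
    sequence. *)
Inductive narrow : clause V -> Prop :=
| NarrowAxiom A of A \in F & #|` A| <= w : narrow A
| NarrowResolve x C D of narrow ((x, true) |` C) & narrow ((x, false) |` D) &
    #|` C `|` D| <= w : narrow (C `|` D).

Definition narrow_reachable (CC : {fset clause V}) :=
  exists p : seq {fset clause V},
    [/\ ohead p = Some fset0, last fset0 p = CC,
        forall t, t.+1 < size p ->
          step F (@res_infers V) (nth fset0 p t) (nth fset0 p t.+1)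
      & forall CC', CC' \in p -> forall C, C \in CC' -> #|` C| <= w].

Lemma narrow_reachable_add CC C :
  narrow_reachable CC -> step F (@res_infers V) CC (C |` CC) -> #|` C| <= w ->
  narrow_reachable (C |` CC).
Proof.
move=> [p [p0 pl ps pw]] st Cw; exists (rcons p (C |` CC)); split.
- by case: p p0 {pl ps pw}.
- by rewrite last_rcons.
- move=> t; rewrite size_rcons ltnS => tp; rewrite !nth_rcons tp.
  case: ltnP => [/ps//|pt].
  have tE : t.+1 = size p by apply/eqP; rewrite eqn_leq tp.
  rewrite tE eqxx (_ : t = (size p).-1); last by rewrite -tE.
  by rewrite nth_last pl.
- have CCw : forall D, D \in CC -> #|` D| <= w.
    apply: pw; rewrite -pl; case: p p0 {pl ps} => //= D q _; exact: mem_last.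
  move=> CC'; rewrite mem_rcons inE => /orP[/eqP-> D /fset1UP[->//|/CCw//]|/pw//].
Qed.

(** The start is arbitrary and nothing is erased, so the second premise can be derived after the
    first, which is still present when they are resolved. *)
Lemma narrow_reachable_mem C : narrow C -> forall CC, narrow_reachable CC ->
  exists2 CC', narrow_reachable CC' & C |` CC `<=` CC'.
Proof.
elim=> {C} [A AF Aw CC rCC|x C D _ IHC _ IHD CDw CC rCC].
  exists (A |` CC) => //.
  by apply: narrow_reachable_add => //; apply: Download.
have [CC1 /IHD[CC2 r2 s2] s1] := IHC _ rCC.
move: s1 s2; rewrite !fsubUset !fsub1set => /andP[C1 s1] /andP[D2 s2].
exists (C `|` D |` CC2).
  apply: narrow_reachable_add => //; apply: Inference.
  by apply: (@Resolve V CC2 x) => //; apply: (fsubsetP s2).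
by apply: fsetUS; apply: fsubset_trans s2.
Qed.

Lemma narrow_refutation : narrow fset0 ->
  exists2 p, res_refutation F p & refutation_width p <= w.
Proof.
move=> n0; have r0 : narrow_reachable fset0.
  exists [:: fset0]; split=> // CC; rewrite inE => /eqP-> C.
  by rewrite inE.
have [CC [p [p0 pl ps pw]] sCC] := narrow_reachable_mem n0 r0.
exists p.
  by split=> //; rewrite pl; apply: (fsubsetP sCC); rewrite !inE eqxx.
apply/bigmax_leqP_seq => CC' CC'p _; apply/bigmax_leqP_seq => C CC'C _.
exact: pw CC'C.
Qed.

(** Inclusion of [C] in [neg_term alpha] means that [alpha] falsifies every literal of [C]. *)
Definition refutes (CC : {fset dnf V}) := forall alpha,
  consistent alpha -> sat_all alpha CC ->
  exists2 C, narrow C & C `<=` neg_term alpha.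

Lemma refutesS CC CC' : CC `<=` CC' -> refutes CC -> refutes CC'.
Proof.
move=> /fsubsetP sub ref alpha ca sa; apply: ref => // D /sub; exact: sa.
Qed.

Lemma narrow_resolve a (C D : clause V) :
  narrow (a |` C) -> narrow (neg a |` D) -> #|` C `|` D| <= w ->
  narrow (C `|` D).
Proof.
case: a => x [] nC nD; first exact: NarrowResolve nC nD.
by rewrite fsetUC; apply: NarrowResolve nD nC.
Qed.

(** In the width bound, [n * r] counts the literals falsified by the shrunk assignment, and [k.-1]
    those of [A] left after at least one has been eliminated. *)
Lemma refutes_download (A : clause V) CC k n r :
  A \in F -> #|` A| <= k -> k <= w -> n * r + k.-1 <= w ->
  (forall D, D \in CC -> rdnf r D) -> #|` CC| <= n ->
  refutes (dnf_of_clause A |` CC) -> refutes CC.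
Proof.
move=> AF Ak kw nw rCC CCn ref alpha0 ca0 sa0.
have [alpha [sub sa card]] := sat_all_small rCC sa0.
have ca := consistentS sub ca0.
suff [C nC Ca] : exists2 C, narrow C & C `<=` neg_term alpha.
  exists C => //; apply: fsubset_trans Ca _; apply/fsubsetP => a.
  by rewrite !mem_neg_term; apply: (fsubsetP sub).
(* [B] holds the literals of [A] not yet eliminated after [m] rounds; none are left when [m] reaches
   the size of [A]. *)
suff key m : m <= #|` A| -> exists C B,
    [/\ narrow C, B `<=` A, C `<=` neg_term alpha `|` B & #|` B| <= #|` A| - m].
  have [C [B [nC _ CB]]] := key _ (leqnn _).
  rewrite subnn leqn0 cardfs_eq0 => /eqP B0; exists C => //.
  by rewrite B0 fsetU0 in CB.
elim: m => [_|m IH mA].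
  exists A, A; split; rewrite ?subn0 ?fsubsetUr //.
  by apply: NarrowAxiom => //; apply: leq_trans kw.
have [C [B [nC BA CB cB]]] := IH (ltnW mA).
have [B0|[a aB]] := fset_0Vmem B.
  by exists C, B; split; rewrite // B0 cardfs0.
have cB' : #|` B `\ a| <= #|` A| - m.+1.
  by move: cB; rewrite (cardfsD1 a B) aB; lia.
have BA' : B `\ a `<=` A by apply: fsubset_trans BA; apply: fsubD1set.
suff [C' nC' C'B] : exists2 C', narrow C' & C' `<=` neg_term alpha `|` (B `\ a).
  by exists C', (B `\ a).
have CaB : C `\ a `<=` neg_term alpha `|` (B `\ a).
  apply/fsubsetP => b /fsetD1P[ba /(fsubsetP CB)]; rewrite !inE.
  by rewrite ba.
have [aC|aC] := boolP (a \in C); last first.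
  exists C => //; apply: fsubset_trans CaB; apply/fsubsetP => b bC.
  by apply/fsetD1P; split=> //; apply: contraNneq aC => <-.
(* If [neg a] is in [alpha], then [a] is already falsified, and adding it would be inconsistent. *)
have [na|na] := boolP (neg a \in alpha).
  exists C => //; rewrite -(fsetD1K aC) fsubUset fsub1set CaB inE mem_neg_term.
  by rewrite na.
(* Adding [a] to [alpha] satisfies [A]. The clause [D] falsified by this extension can exceed
   [neg_term alpha] only by [neg a], on which it is resolved with [C]. *)
have [|D nD Dsub] := ref (a |` alpha) (consistentU1 ca na).
  move=> E /fset1UP[->|/sa]; last exact: satS (fsubsetUr _ _).
  apply: satS (fsubsetUl _ _) (sat_clause _); exact: (fsubsetP BA).
have Da : D `\ neg a `<=` neg_term alpha.
  apply/fsubsetP => b /fsetD1P[ba /(fsubsetP Dsub)].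
  rewrite !mem_neg_term !inE => /orP[/eqP ba'|//].
  by rewrite -ba' negK eqxx in ba.
have Da' := fsubset_trans Da (fsubsetUl _ (B `\ a)).
have [aD|aD] := boolP (neg a \in D); last first.
  exists D => //; apply: fsubset_trans Da'; apply/fsubsetP => b bD.
  by apply/fsetD1P; split=> //; apply: contraNneq aD => <-.
exists (C `\ a `|` D `\ neg a); last by rewrite fsubUset CaB.
apply: (@narrow_resolve a); rewrite ?fsetD1K //.
have /fsubset_leq_card/leq_trans-> // :
  C `\ a `|` D `\ neg a `<=` neg_term alpha `|` (B `\ a) by rewrite fsubUset CaB.
rewrite cardfsU card_neg_term; apply: leq_trans (leq_subr _ _) _.
apply: leq_trans nw; apply: leq_add.
  by apply: leq_trans card _; rewrite leq_mul2r CCn orbT.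
by move: cB' mA Ak; lia.
Qed.

End NarrowResolution.

(* Asking for a subconfiguration with at most [s - 1] formulas is what gains
   the factor [s - 2]: a download into a configuration of [s - 1] formulas is
   followed by an erasure, which may as well be done first. *)
Lemma narrow_of_rdnf_refutation (V : choiceType) (F : cnf V) (k r s w : nat)
    (p : seq {fset dnf V}) :
  kcnf k F -> rdnf_refutation r F p -> refutation_space p <= s -> 1 < s ->
  k <= w -> (s - 2) * r + k.-1 <= w -> narrow F w fset0.
Proof.
move=> [_ kF] [rp ref_p] sp s1 kw sw.
pose R CC := exists CC', [/\ CC' `<=` CC, #|` CC'| <= s - 1 & refutes F w CC'].
suff [CC0 [sub0 _ ref0]] : R fset0.
  have [|C nC] := ref0 fset0 (@consistent0 V).
    by move=> D /(fsubsetP sub0); rewrite inE.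
  have -> : neg_term (fset0 : term V) = fset0.
    by apply/fsetP => a; rewrite mem_neg_term !inE.
  by rewrite fsubset0 => /eqP <-.
have : R (last fset0 p) -> R fset0.
  (* Forward induction on this implication walks backwards from the last configuration. *)
  apply: (refutation_ind (I := fun CC => R CC -> R fset0) ref_p) => //.
  move=> CC CC' CCp CC'p st IH RCC'; apply: IH.
  case: st CC'p RCC' =>
    [_ /imfsetP[A /= AF ->]|D inf|D _] CC'p [CC1 [sub1 c1 ref1]].
  - have subA : CC1 `\ dnf_of_clause A `<=` CC.
      apply/fsubsetP => E /fsetD1P[EA /(fsubsetP sub1)].
      by case/fset1UP=> // EE; rewrite EE eqxx in EA.
    exists (CC1 `\ dnf_of_clause A); split=> //.
      by apply: leq_trans c1; apply: fsubset_leq_card; apply: fsubD1set.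
    (* If the axiom lies in [CC1], removing it leaves at most [s - 2] formulas, the [n] of
       [refutes_download]. *)
    have [AC|AC] := boolP (dnf_of_clause A \in CC1).
      apply: refutes_download AF (kF _ AF) kw sw _ _ _.
      + by move=> E /(fsubsetP subA); apply: (rp _ CCp).
      + by move: c1; rewrite (cardfsD1 (dnf_of_clause A)) AC; lia.
      + by rewrite fsetD1K.
    apply: refutesS ref1; apply/fsubsetP => b bC.
    by apply/fsetD1P; split=> //; apply: contraNneq AC => <-.
  - have [DCC|DCC] := boolP (D \in CC).
      exists CC1; split=> //; apply: fsubset_trans sub1 _.
      by rewrite fsubUset fsub1set DCC fsubset_refl.
    (* As [D] is new and fits in space [s] together with [CC], the latter has at most [s - 1]
       formulas. *)
    exists CC; split; first exact: fsubset_refl.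
      have := leq_trans (refutation_space_ge CC'p) sp.
      by rewrite cardfsU1 DCC; lia.
    move=> alpha ca sa; apply: ref1 => // E /(fsubsetP sub1)/fset1UP[->|/sa//].
    exact: rdnf_infers_sound inf ca sa.
  - exists CC1; split=> //; apply: fsubset_trans sub1 _; exact: fsubD1set.
(* The empty DNF alone is unsatisfiable, so the invariant holds vacuously. *)
apply; exists [fset fset0]; split.
- by case: ref_p => _ bot _; rewrite fsub1set.
- by rewrite cardfs1; lia.
- by move=> alpha _ /(_ fset0); rewrite inE eqxx => /(_ isT)[].
Qed.

Theorem theorem3p7 (V : choiceType) (F : cnf V) (k r s : nat)
    (pi : seq {fset dnf V}) :
  kcnf k F -> rdnf_refutation r F pi -> refutation_space pi <= s ->
  exists pi' : seq {fset clause V},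
    res_refutation F pi' /\
    ((refutation_width pi')%:Z <= (s%:Z - 2) * r%:Z + k%:Z - 1)%R.
Proof.
move=> kF rpi spi; have [F0 kF'] := kF.
(* Positivity of [s - 2], [r] and [k] makes the axioms fit in the width and the truncated
   subtractions agree with the integer ones. *)
have s2 : 2 < s := leq_trans (rdnf_refutation_space_gt2 rpi F0) spi.
have [A AF rA] := rdnf_refutation_uses_axiom rpi.
have [A0|[a aA]] := fset_0Vmem A; first by rewrite A0 (negPf F0) in AF.
have r0 : 0 < r.
  by rewrite -(cardfs1 a); apply: rA; apply: in_imfset.
have k0 : 0 < k.
  by apply: leq_trans (kF' _ AF); rewrite cardfs_gt0; apply/fset0Pn; exists a.
have kw : k <= (s - 2) * r + k.-1.
  have : 0 < (s - 2) * r by rewrite muln_gt0 subn_gt0 s2.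
  by lia.
have n0 := narrow_of_rdnf_refutation kF rpi spi (ltnW s2) kw (leqnn _).
have [p ref_p wp] := narrow_refutation n0.
by exists p; split=> //; nia.
Qed.
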